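(* Let $\mu$ be a finite Borel measure on $[0,1)$ with Radon-Nikodym derivative $g$. Suppose that there is a Bessel sequence $\{g_n\}_{n=-\infty}^{\infty}$ in $L^2(\mu)$ with bound $B$ that is dextrodual to $\{e^{2\pi i n x}\}_{n=-\infty}^{\infty}$ in $L^2(\mu)$. Then $$g(x)>\frac{1}{3B}$$ for almost every $x$ in the support of $g$.
   Context: Measures are positive. The Radon-Nikodym derivative $g$ of $\mu$ means the density of the absolutely continuous part of $\mu$ with respect to Lebesgue measure ($\mu$ may also have a singular part). The support of $g$ is $\{x:g(x)>0\}$, and ''almost every'' is with respect to Lebesgue measure. A sequence $\{g_n\}$ in a Hilbert space $H$ is a Bessel sequence with bound $B>0$ if $\sum_n|\langle f,g_n\rangle|^2\le B\|f\|^2$ for all $f\in H$. A sequence $\{g_n\}$ is dextrodual to a sequence $\{x_n\}$ in $H$ if for all $x\in H$, $x=\sum_n\langle x,g_n\rangle x_n$, with (possibly conditional) convergence in norm; for sequences indexed by $\mathbb Z$ the sum is the limit of the symmetric partial sums $\sum_{n=-M}^{M}$ as $M\to\infty$. *)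

(* Defs.v *)
From HB Require Import structures.
From mathcomp Require Import all_boot all_order all_algebra.
From mathcomp Require Import all_classical all_reals all_analysis.
From mathcomp Require Import complex.

Set Implicit Arguments.
Unset Strict Implicit.
Unset Printing Implicit Defensive.

Import Order.TTheory GRing.Theory Num.Theory.
Import numFieldNormedType.Exports.

Local Open Scope classical_set_scope.
Local Open Scope ring_scope.
Local Open Scope complex_scope.

Section ComplexL2.
Context d (T : measurableType d) (R : realType).
Variable mu : {measure set T -> \bar R}.

(* `|z| lives in R[i]; this is the same modulus as an element of R. *)
Definition modulus (z : R[i]) : R := complex.Re `|z|.

Definition complex_integral (f : T -> R[i]) : R[i] :=
  (\int[mu]_x complex.Re (f x)) +i* (\int[mu]_x complex.Im (f x)).

Definition L2_norm (f : T -> R[i]) : \bar R :=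
  'N[mu]_2%:E[EFin \o modulus \o f]%E.

(* Elements of the complex space L^2(mu) are handled through representatives;
   every notion below depends only on classes modulo mu-a.e. equality. *)
Definition L2 : set (T -> R[i]) := [set f |
  [/\ measurable_fun [set: T] (fun x => complex.Re (f x)),
      measurable_fun [set: T] (fun x => complex.Im (f x)) &
      (L2_norm f < +oo)%E]].

Definition inner (f h : T -> R[i]) : R[i] :=
  complex_integral (fun x => f x * (h x)^*).

Definition bessel_sequence (h : int -> T -> R[i]) (B : R) : Prop :=
  [/\ 0 < B, forall n, L2 (h n) &
      forall f, L2 f ->
        (\esum_(n in [set: int]) (modulus (inner f (h n)) ^+ 2)%:E
         <= B%:E * L2_norm f ^+ 2)%E].

Definition symmetric_partial_sum (u : int -> R[i]) (M : nat) : R[i] :=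
  \sum_(0 <= k < M.*2.+1) u (k%:Z - M%:Z).

Definition dextrodual (h e : int -> T -> R[i]) : Prop :=
  forall f, L2 f ->
    (fun M : nat => L2_norm (fun x =>
       f x - symmetric_partial_sum (fun n => inner f (h n) * e n x) M))
      @ \oo --> 0%E.

End ComplexL2.

Definition exponential (R : realType) (n : int) (x : R) : R[i] :=
  cos (2 * pi * n%:~R * x) +i* sin (2 * pi * n%:~R * x).

Definition mutually_singular d (T : measurableType d) (R : realType)
    (mu nu : {measure set T -> \bar R}) : Prop :=
  exists N : set T, [/\ measurable N, mu (~` N) = 0%E & nu N = 0%E].

(* g is determined up to Lebesgue-null sets by the uniqueness of the Lebesgue
   decomposition. *)
Definition is_ac_density (R : realType)
    (mu : {measure set (measurableTypeR R) -> \bar R}) (g : R -> R) : Prop :=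
  [/\ measurable_fun [set: measurableTypeR R] g, forall x, 0 <= g x &
      exists2 nu : {measure set (measurableTypeR R) -> \bar R},
        mutually_singular nu (@lebesgue_measure R) &
        forall A : set (measurableTypeR R), measurable A ->
          mu A = (\int[@lebesgue_measure R]_(x in A) (g x)%:E + nu A)%E].

(* Main.v *)
(* If f in L^2(mu) and c_n = <f, g_n>, the symmetric partial sums S_M of
   sum c_n e^{2 pi i n x} converge to f in L^2(mu), and by Parseval on [0, 1]
   and the Bessel bound their L^2(dx) norms are at most sqrt B * ||f||. Take f
   to be the indicator of a set E, disjoint from the singular part, on which
   eps <= g <= 1/(3B). There dx is dominated by mu / eps, so S_M tends to 1
   in Lebesgue measure on E. Therefore |E| is at most a constant below 3 times
   B mu(E) <= |E| / 3, which forces |E| = 0. *)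
Require Import Defs.
From mathcomp Require Import all_boot all_order all_algebra.
From mathcomp Require Import all_classical all_reals all_analysis.
From mathcomp Require Import measurable_realfun complex ring lra.

Set Implicit Arguments.
Unset Strict Implicit.
Unset Printing Implicit Defensive.

Import Order.TTheory GRing.Theory Num.Theory.
Import numFieldNormedType.Exports.

Local Open Scope classical_set_scope.
Local Open Scope ring_scope.
Local Open Scope complex_scope.

(** * The real-valued modulus and sums of complex numbers *)

Section Modulus.
Variable R : realType.
Implicit Types z w : R[i].

Lemma sqr_modulus z : modulus z ^+ 2 = complex.Re z ^+ 2 + complex.Im z ^+ 2.
Proof. by rewrite /modulus normc_def sqr_sqrtr// addr_ge0// sqr_ge0. Qed.

(** In [R[i]] an inequality means equal imaginary parts and ordered real parts, so the real
    component of the complex triangle inequality is the claim. *)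
Lemma le_modulusD z w : modulus (z + w) <= modulus z + modulus w.
Proof. by have := ler_normD z w; rewrite lecE => /andP[_]. Qed.

Lemma Re_sum I (s : seq I) (F : I -> R[i]) :
  complex.Re (\sum_(i <- s) F i) = \sum_(i <- s) complex.Re (F i).
Proof.
have D (z w : R[i]) : complex.Re (z + w) = complex.Re z + complex.Re w.
  by case: z; case: w.
by elim/big_rec2: _ => // i x y _ <-; exact: D.
Qed.

Lemma Im_sum I (s : seq I) (F : I -> R[i]) :
  complex.Im (\sum_(i <- s) F i) = \sum_(i <- s) complex.Im (F i).
Proof.
have D (z w : R[i]) : complex.Im (z + w) = complex.Im z + complex.Im w.
  by case: z; case: w.
by elim/big_rec2: _ => // i x y _ <-; exact: D.
Qed.

Lemma sqr_modulus_mulC z : modulus z ^+ 2 = complex.Re (z * z^*).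
Proof. by case: z => a b; rewrite sqr_modulus /=; ring. Qed.

(** Expanding z times its conjugate gives a double sum that can be integrated term by term in
    Parseval's identity. *)
Lemma sqr_modulus_sum I (s : seq I) (F : I -> R[i]) :
  modulus (\sum_(i <- s) F i) ^+ 2 =
  \sum_(i <- s) \sum_(j <- s) complex.Re (F i * (F j)^*).
Proof.
rewrite sqr_modulus_mulC rmorph_sum big_distrlr/= Re_sum.
by apply: eq_bigr => i _; exact: Re_sum.
Qed.

End Modulus.

(** * Integrals of the exponentials over one period *)

Section Exponential.
Variable R : realType.

Lemma exponential_mulC (m n : int) (x : R) :
  exponential m x * (exponential n x)^* = exponential (m - n) x.
Proof.
rewrite /exponential intrB; set a := 2 * pi * m%:~R * x; set b := _ * n%:~R * x.
have -> : 2 * pi * (m%:~R - n%:~R) * x = a - b by rewrite /a /b; ring.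
by apply/eqP; rewrite eq_complex/= cosB sinB; apply/andP; split; apply/eqP; ring.
Qed.

Lemma sin_2pi_int (n : int) : sin (2 * pi * n%:~R) = 0 :> R.
Proof.
have sin_nat k : sin (2 * pi * k%:R) = 0 :> R.
  rewrite -[RHS]sin0 -(periodicn (@sinD2pi R) k 0) add0r; congr sin.
  by rewrite -mulrnA -[RHS]mulr_natl natrM; ring.
case: n => k; first exact: sin_nat.
by rewrite NegzE mulrNz mulrN sinN sin_nat oppr0.
Qed.

Lemma cos_2pi_int (n : int) : cos (2 * pi * n%:~R) = 1 :> R.
Proof.
have cos_nat k : cos (2 * pi * k%:R) = 1 :> R.
  rewrite -[RHS]cos0 -(periodicn (@cosD2pi R) k 0) add0r; congr cos.
  by rewrite -mulrnA -[RHS]mulr_natl natrM; ring.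
case: n => k; first exact: cos_nat.
by rewrite NegzE mulrNz mulrN cosN cos_nat.
Qed.

(** Fundamental theorem of calculus: differentiability on the whole line supplies the one-sided
    limits of [F] at the endpoints. *)
Lemma Rintegral_derive01 (F f : R -> R) : continuous f ->
  (forall x : R, is_derive x 1 F (f x)) ->
  (\int[lebesgue_measure]_(x in `[0, 1]) f x)%R = F 1 - F 0.
Proof.
move=> cf dF; rewrite /Rintegral (@continuous_FTC2 _ f F)//.
- exact: continuous_subspaceT.
- have cF x : {for x, continuous F}.
    by apply/differentiable_continuous/derivable1_diffP; case: (dF x).
  split => [x _| |]; first by case: (dF x).
  + exact/cvg_at_right_filter/cF.
  + exact/cvg_at_left_filter/cF.
- by move=> x _; rewrite derive1E derive_val.
Qed.

Lemma continuous_cosZ (a : R) : continuous (fun x => cos (a * x)).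
Proof.
move=> x; apply: (continuous_comp (f := fun x => a * x)).
  by apply: continuousM; [exact: cst_continuous|exact: cvg_id].
exact: continuous_cos.
Qed.

Lemma continuous_sinZ (a : R) : continuous (fun x => sin (a * x)).
Proof.
move=> x; apply: (continuous_comp (f := fun x => a * x)).
  by apply: continuousM; [exact: cst_continuous|exact: cvg_id].
exact: continuous_sin.
Qed.

Lemma lebesgue_measure01 : lebesgue_measure (`[0, 1]%classic : set R) = 1%E.
Proof. by rewrite lebesgue_measure_itv/= lte_fin ltr01 sube0. Qed.

(** For nonzero [n], with a = 2 pi n, the antiderivatives sin(ax)/a and -cos(ax)/a agree at 0 and 1;
    for [n = 0] the integrands are constant. *)
Lemma Rintegral_exponential (n : int) :
  (\int[lebesgue_measure]_(x in `[0, 1]) complex.Re (exponential n x))%R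
    = (n == 0)%:R :> R /\
  (\int[lebesgue_measure]_(x in `[0, 1]) complex.Im (exponential n x))%R
    = 0 :> R.
Proof.
rewrite /exponential /=.
have [->|n0] := eqVneq n 0.
  split.
    under eq_Rintegral do rewrite mulr0 mul0r cos0.
    have := Rintegral_cst lebesgue_measure (measurable_itv `[0, 1]) (1 : R).
    by move->; rewrite -[X in fine X]/(lebesgue_measure _) lebesgue_measure01 mul1r.
  under eq_Rintegral do rewrite mulr0 mul0r sin0.
  have := Rintegral_cst lebesgue_measure (measurable_itv `[0, 1]) (0 : R).
  by move->; rewrite mul0r.
set a := 2 * pi * n%:~R.
have a0 : a != 0.
  by rewrite !mulf_neq0 ?pnatr_eq0 ?intr_eq0 ?(lt0r_neq0 (pi_gt0 R)).
split.
  have dF (x : R) : is_derive x 1 (fun y : R => a^-1 * sin (a * y)) (cos (a * x)).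
    apply: is_derive_eq.
    by rewrite /GRing.scale/=; field.
  rewrite (Rintegral_derive01 (@continuous_cosZ a) dF).
  by rewrite mulr1 mulr0 sin0 mulr0 subr0 /a sin_2pi_int mulr0.
have dF (x : R) : is_derive x 1 (fun y : R => - a^-1 * cos (a * y)) (sin (a * x)).
  apply: is_derive_eq.
  by rewrite /GRing.scale/=; field.
rewrite (Rintegral_derive01 (@continuous_sinZ a) dF).
by rewrite mulr1 mulr0 cos0 /a cos_2pi_int subrr.
Qed.
End Exponential.

(** * Parseval's identity for trigonometric polynomials *)

Section TrigonometricPolynomial.
Variable R : realType.
Local Notation leb := (@lebesgue_measure R).

Lemma continuous_integrable01 (f : R -> R) :
  continuous f -> leb.-integrable `[0, 1] (EFin \o f).
Proof.
move=> cf; apply: continuous_compact_integrable; first exact: segment_compact.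
exact: continuous_subspaceT.
Qed.

Lemma continuous_bigsum I (s : seq I) (F : I -> R -> R) :
  (forall i, continuous (F i)) -> continuous (fun x => \sum_(i <- s) F i x).
Proof.
move=> cF; elim: s => [|i s IH] x.
  under eq_fun do rewrite big_nil.
  exact: cst_continuous.
under eq_fun do rewrite big_cons.
by apply: continuousD; [exact: cF|exact: IH].
Qed.

Lemma Rintegral_sum01 I (s : seq I) (F : I -> R -> R) :
  (forall i, continuous (F i)) ->
  (\int[leb]_(x in `[0, 1]) \sum_(i <- s) F i x)%R =
  \sum_(i <- s) (\int[leb]_(x in `[0, 1]) F i x)%R.
Proof.
move=> cF; elim: s => [|i s IH].
  rewrite big_nil; under eq_Rintegral do rewrite big_nil.
  have := Rintegral_cst leb (measurable_itv `[0, 1]) (0 : R).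
  by move->; rewrite mul0r.
rewrite big_cons -IH; under eq_Rintegral do rewrite big_cons.
apply: RintegralD => //; first exact/continuous_integrable01/cF.
exact/continuous_integrable01/continuous_bigsum.
Qed.

Lemma continuous_exponential_Re (n : int) :
  continuous (fun x : R => complex.Re (exponential n x)).
Proof. exact: continuous_cosZ. Qed.

Lemma continuous_exponential_Im (n : int) :
  continuous (fun x : R => complex.Im (exponential n x)).
Proof. exact: continuous_sinZ. Qed.

Lemma continuous_scaler (a : R) (f : R -> R) :
  continuous f -> continuous (fun x => a * f x).
Proof. by move=> cf x; apply: continuousM; [exact: cst_continuous|exact: cf]. Qed.

Lemma continuous_lincomb (a b : R) (f g : R -> R) :
  continuous f -> continuous g -> continuous (fun x => a * f x + b * g x).
Proof.
move=> cf cg x.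
exact: (cvgD (@continuous_scaler a f cf x) (@continuous_scaler b g cg x)).
Qed.

(** The sign sits on the coefficient so that the right side has the shape treated by
    [continuous_lincomb]. *)
Lemma Re_mulE (z w : R[i]) : complex.Re (z * w) =
  complex.Re z * complex.Re w + - complex.Im z * complex.Im w.
Proof. by case: z w => a b [c d] /=; rewrite mulNr. Qed.

Lemma Im_mulE (z w : R[i]) : complex.Im (z * w) =
  complex.Re z * complex.Im w + complex.Im z * complex.Re w.
Proof. by case: z w => a b [c d] /=. Qed.

Lemma continuous_Re_mul_exponential (z : R[i]) (n : int) :
  continuous (fun x : R => complex.Re (z * exponential n x)).
Proof.
rewrite (_ : (fun x => _) = (fun x : R =>
    complex.Re z * complex.Re (exponential n x) +
    - complex.Im z * complex.Im (exponential n x))); last first.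
  by apply/funext => x; exact: Re_mulE.
exact: continuous_lincomb
  (@continuous_exponential_Re n)
  (@continuous_exponential_Im n).
Qed.

Lemma continuous_Im_mul_exponential (z : R[i]) (n : int) :
  continuous (fun x : R => complex.Im (z * exponential n x)).
Proof.
rewrite (_ : (fun x => _) = (fun x : R =>
    complex.Re z * complex.Im (exponential n x) +
    complex.Im z * complex.Re (exponential n x))); last first.
  by apply/funext => x; exact: Im_mulE.
exact: continuous_lincomb
  (@continuous_exponential_Im n)
  (@continuous_exponential_Re n).
Qed.

Lemma Rintegral_Re_mul_exponential (z : R[i]) (n : int) :
  (\int[leb]_(x in `[0, 1]) complex.Re (z * exponential n x))%R
  = complex.Re z * (n == 0)%:R.
Proof.
have cRe := continuous_integrable01 (@continuous_exponential_Re n).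
have cIm := continuous_integrable01 (@continuous_exponential_Im n).
have [iRe iIm] := Rintegral_exponential R n.
under eq_Rintegral do rewrite Re_mulE.
rewrite RintegralD//.
- by rewrite !RintegralZl// iRe iIm mulr0 addr0.
- exact/continuous_integrable01/continuous_scaler/continuous_exponential_Re.
- exact/continuous_integrable01/continuous_scaler/continuous_exponential_Im.
Qed.

(** In the double sum the term (m, n) carries the exponential of frequency m - n, whose integral
    vanishes off the diagonal. Since [s] has no duplicates, each m meets the diagonal exactly
    once. *)
Lemma parseval_exponential (s : seq int) (c : int -> R[i]) : uniq s ->
  (\int[leb]_(x in `[0%R, 1%R])
    ((modulus (\sum_(n <- s) c n * exponential n x) ^+ 2)%R)%:E =
  (\sum_(n <- s) modulus (c n) ^+ 2)%:E)%E.
Proof.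
move=> s_uniq.
have E x : modulus (\sum_(n <- s) c n * exponential n x) ^+ 2 =
    \sum_(m <- s) \sum_(n <- s)
      complex.Re (c m * (c n)^* * exponential (m - n) x) :> R.
  rewrite sqr_modulus_sum; apply: eq_bigr => m _; apply: eq_bigr => n _.
  by rewrite rmorphM -exponential_mulC mulrACA.
have cts m n : continuous (fun x : R =>
    complex.Re (c m * (c n)^* * exponential (m - n) x)).
  exact: continuous_Re_mul_exponential.
have cts2 m : continuous (fun x : R => \sum_(n <- s)
    complex.Re (c m * (c n)^* * exponential (m - n) x)).
  exact: continuous_bigsum.
under eq_integral do rewrite E.
(* The integrand is continuous, hence integrable on [0, 1], so the extended integral may be replaced
   by the real one. *)
rewrite -[LHS]fineK; last first.
  apply: integrable_fin_num => //.
  exact/continuous_integrable01/continuous_bigsum.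
congr EFin.
transitivity (\sum_(m <- s) (\int[leb]_(x in `[0, 1]) \sum_(n <- s)
    complex.Re (c m * (c n)^* * exponential (m - n) x))%R).
  exact: Rintegral_sum01.
apply: eq_big_seq => m ms.
rewrite Rintegral_sum01// (bigD1_seq m)//= big1 ?addr0.
  by rewrite Rintegral_Re_mul_exponential subrr eqxx mulr1 -sqr_modulus_mulC.
move=> n nm; rewrite Rintegral_Re_mul_exponential subr_eq0 eq_sym (negbTE nm).
by rewrite mulr0.
Qed.

End TrigonometricPolynomial.

(** * Squared norms, indicators and Chebyshev's inequality *)

Section L2Norm.
Context d (T : measurableType d) (R : realType).
Variable mu : {measure set T -> \bar R}.

(** The integer and real powers agree on nonnegative reals and at [+oo], so functions of infinite
    norm are covered as well. *)
Lemma sqr_L2_norm (f : T -> R[i]) :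
  (L2_norm mu f ^+ 2 = \int[mu]_x ((modulus (f x) ^+ 2)%R)%:E)%E.
Proof.
transitivity (L2_norm mu f `^ 2)%E.
  have : (0 <= L2_norm mu f)%E by exact: Lnorm_ge0.
  case: (L2_norm mu f) => [r| |]//; last by rewrite poweRyr.
  by rewrite lee_fin => r0; rewrite poweR_EFin powR_mulrn// EFin_expe.
rewrite powR_Lnorm//; apply: eq_integral => x _ /=.
by rewrite powR_mulrn// real_normK// num_real.
Qed.

Lemma measurable_sqr_modulus (f : T -> R[i]) :
  measurable_fun [set: T] (fun x => complex.Re (f x)) ->
  measurable_fun [set: T] (fun x => complex.Im (f x)) ->
  measurable_fun [set: T] (fun x => modulus (f x) ^+ 2).
Proof.
move=> mR mI; under eq_fun do rewrite sqr_modulus.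
by apply: measurable_funD; exact: measurable_funX.
Qed.

Lemma sqr_L2_norm_indic (E : set T) : measurable E ->
  (L2_norm mu (fun x => (\1_E x)%:C) ^+ 2 = mu E)%E.
Proof.
move=> mE; rewrite sqr_L2_norm -[in RHS](setIT E) -integral_indic//.
apply: eq_integral => x _; rewrite sqr_modulus /= indicE.
by case: (x \in E) => /=; rewrite ?expr1n ?expr0n addr0.
Qed.

Lemma L2_indic (E : set T) : measurable E -> (mu E < +oo)%E ->
  L2 mu (fun x => (\1_E x)%:C).
Proof.
move=> mE muE; split => /=; [exact: measurable_indic|exact: measurable_cst|].
rewrite ltNge; apply/negP; rewrite leye_eq => /eqP N.
by move: muE; rewrite -sqr_L2_norm_indic// N.
Qed.

(** Serves two measures: [mu] on the whole line for the approximation error, and Lebesgue measure on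
    [0, 1] for the partial sums. *)
Lemma chebyshev_ge0 (D : set T) (f : T -> R) (r : R) : 0 < r ->
  measurable D -> measurable_fun D f -> (forall x, 0 <= f x) ->
  (r%:E * mu (D `&` [set x | (r <= f x)%R]) <= \int[mu]_(x in D) (f x)%:E)%E.
Proof.
move=> r0 mD mf f0.
have abs_f x : (`|(f x)%:E| = (f x)%:E)%E by rewrite gee0_abs// lee_fin.
have := le_integral_abse mu mD (proj2 (measurable_EFinP D f) mf) r0.
rewrite [X in (_ <= X)%E -> _](eq_integral (EFin \o f)); last first.
  by move=> x _; exact: abs_f.
rewrite (_ : [set x | _] = [set x | r <= f x])//.
by apply/seteqP; split => x /=; rewrite -lee_fin -abs_f.
Qed.
End L2Norm.

(** * Lebesgue measure bounded through the Bessel and dextrodual properties *)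

Section Bessel.
Variables (R : realType) (mu : {finite_measure set (measurableTypeR R) -> \bar R}).
Variables (h : int -> measurableTypeR R -> R[i]) (B : R).
Local Notation leb := (@lebesgue_measure R).

(** Listing the frequencies without repetition puts symmetric partial sums in the form required by
    Parseval and by the finite Bessel bound. *)
Definition symmetric_range (M : nat) : seq int :=
  [seq k%:Z - M%:Z | k <- index_iota 0 M.*2.+1].

Lemma symmetric_range_uniq M : uniq (symmetric_range M).
Proof. by rewrite map_inj_uniq ?iota_uniq// => a b /addIr []. Qed.

Lemma symmetric_partial_sumE (u : int -> R[i]) M :
  symmetric_partial_sum u M = \sum_(n <- symmetric_range M) u n.
Proof. by rewrite /symmetric_partial_sum /symmetric_range big_map. Qed.

(** An [esum] is a supremum over finite subsets, and a list without duplicates represents one of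
    them. *)
Lemma bessel_finite (s : seq int) (f : measurableTypeR R -> R[i]) :
  bessel_sequence mu h B -> uniq s -> L2 mu f ->
  ((\sum_(n <- s) modulus (inner mu f (h n)) ^+ 2)%:E
   <= B%:E * L2_norm mu f ^+ 2)%E.
Proof.
move=> [_ _ bes] us Lf; apply: le_trans (bes f Lf).
apply: esum_ge; exists [set` s]; first by split => //; exact: finite_seq.
by rewrite -fsbig_seq// sumEFin.
Qed.

Lemma measurable_exponential_sum (s : seq int) (c : int -> R[i]) :
  measurable_fun [set: measurableTypeR R]
    (fun x => complex.Re (\sum_(n <- s) c n * exponential n x)) /\
  measurable_fun [set: measurableTypeR R]
    (fun x => complex.Im (\sum_(n <- s) c n * exponential n x)).
Proof.
split; apply: continuous_measurable_fun.
  under eq_fun do rewrite Re_sum.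
  by apply: continuous_bigsum => n; exact: continuous_Re_mul_exponential.
under eq_fun do rewrite Im_sum.
by apply: continuous_bigsum => n; exact: continuous_Im_mul_exponential.
Qed.

(* The constant is (3/4)^-2: off the set where |1 - S M| >= 1/4, which is
   asymptotically null, E is contained in {|S M| >= 3/4}. *)
Lemma lebesgue_le_bessel (E : set (measurableTypeR R)) (eps : R) :
  bessel_sequence mu h B -> dextrodual mu h (@exponential R) ->
  measurable E -> E `<=` `[0, 1] -> 0 < eps ->
  (forall A, measurable A -> A `<=` E -> (eps%:E * leb A <= mu A)%E) ->
  (leb E <= (16 / 9 * B)%:E * mu E)%E.
Proof.
move=> bes dex mE E01 eps0 dom.
pose f (x : measurableTypeR R) : R[i] := (\1_E x)%:C.
have muE : (mu E < +oo)%E by rewrite ltey_eq fin_num_measure.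
have Lf : L2 mu f by exact: L2_indic.
have normf : (L2_norm mu f ^+ 2 = mu E)%E by exact: sqr_L2_norm_indic.
pose c n := inner mu f (h n).
pose S M (x : measurableTypeR R) :=
  \sum_(n <- symmetric_range M) c n * exponential n x.
pose N M := L2_norm mu (fun x => f x - S M x).
have N0 : N M @[M --> \oo] --> 0%E.
  rewrite /N /S; under eq_fun do under eq_fun do rewrite -symmetric_partial_sumE.
  exact: dex.
(* At fixed [M], the first term accounts for the points of [E] where [S M] is far from 1, the second
   for those where [S M] is large. *)
have bound M : (leb E <= (16 / eps)%:E * N M ^+ 2 + (16 / 9 * B)%:E * mu E)%E.
  have [mSR mSI] := measurable_exponential_sum (symmetric_range M) c.
  have mDR : measurable_fun [set: measurableTypeR R]
      (fun x => complex.Re (f x - S M x)).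
    rewrite (_ : (fun x => _) = (fun x => \1_E x - complex.Re (S M x))).
      by apply: measurable_funB.
    by apply/funext => x; rewrite /f; case: (S M x).
  have mDI : measurable_fun [set: measurableTypeR R]
      (fun x => complex.Im (f x - S M x)).
    rewrite (_ : (fun x => _) = (fun x => 0 - complex.Im (S M x))).
      by apply: measurable_funB.
    by apply/funext => x; rewrite /f; case: (S M x).
  (* The thresholds are the squares of 1/4 and 3/4, which add up to [f = 1] on [E]. *)
  pose P := [set x : measurableTypeR R | (16^-1 <= modulus (f x - S M x) ^+ 2)%R].
  pose Q := [set x : measurableTypeR R | (9 / 16 <= modulus (S M x) ^+ 2)%R].
  have mP : measurable P.
    by rewrite -[P]setTI; apply: measurable_fun_le => //;
      exact: measurable_sqr_modulus.
  have mS2 := measurable_sqr_modulus mSR mSI.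
  have mQ : measurable Q by rewrite -[Q]setTI; apply: measurable_fun_le.
  have cover : E `<=` (E `&` P) `|` (`[0%R, 1%R]%classic `&` Q).
    move=> x Ex; have [Px|nPx] := pselect (P x); [by left|right].
    split; first exact: E01.
    move/negP : nPx; rewrite -ltNge => lt16.
    have le1 : 1 <= modulus (f x - S M x) + modulus (S M x).
      apply: le_trans (le_modulusD _ _).
      by rewrite subrK /f indicE mem_set//= /modulus normr1.
    have lt4 : modulus (f x - S M x) < 4^-1.
      rewrite ltNge; apply/negP => le4.
      have : 4^-1 * 4^-1 <= modulus (f x - S M x) ^+ 2.
        by rewrite expr2 ler_pM.
      lra.
    have ge34 : 3 / 4 <= modulus (S M x) by lra.
    have : 3 / 4 * (3 / 4) <= modulus (S M x) ^+ 2 by rewrite expr2 ler_pM.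
    rewrite /Q /=; lra.
  have mEP : measurable (E `&` P) by exact: measurableI.
  have mIQ : measurable (`[0%R, 1%R]%classic `&` Q) by exact: measurableI.
  apply: (le_trans (le_measure leb _ _ cover)).
  - by rewrite inE.
  - by rewrite inE; exact: measurableU.
  apply: (le_trans (measureU2 leb mEP mIQ)); apply: leeD.
    (* Points of [E] in [P]: [dom] replaces [eps] times Lebesgue measure by [mu], and Chebyshev for
       [mu] bounds the measure of [P] by the squared error. *)
    rewrite -(@invf_div _ eps 16) lee_pdivlMl ?divr_gt0//.
    rewrite mulrC EFinM -muleA.
    apply: (@le_trans _ _ (16^-1%:E * mu (E `&` P)))%E.
      apply: lee_wpmul2l; first by rewrite lee_fin.
      by apply: dom => // x [].
    apply: (@le_trans _ _ (16^-1%:E * mu P))%E.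
      apply: lee_wpmul2l; first by rewrite lee_fin.
      by apply: le_measure; rewrite ?inE.
    rewrite /N sqr_L2_norm -[P]setTI; apply: chebyshev_ge0 => //.
    - exact: measurable_sqr_modulus.
    - by move=> x; exact: sqr_ge0.
  (* Points of [0, 1] in [Q]: Chebyshev for Lebesgue measure, then Parseval over the full period,
     then Bessel with the squared norm of [f] equal to [mu E]. *)
  rewrite (_ : 16 / 9 * B = (9 / 16)^-1 * B)%R; last by rewrite invf_div.
  rewrite EFinM -muleA lee_pdivlMl ?divr_gt0// -normf.
  apply: le_trans (bessel_finite bes (symmetric_range_uniq M) Lf).
  rewrite -parseval_exponential ?symmetric_range_uniq//.
  apply: chebyshev_ge0 => //.
  - exact: measurable_funTS.
  - by move=> x; exact: sqr_ge0.
(* Only the error term depends on [M]; its limit is written with [0 * 0] to match the product rule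
   for limits. *)
have cvg_bound : (((16 / eps)%:E * N M ^+ 2 + (16 / 9 * B)%:E * mu E)%E
    @[M --> \oo] --> ((16 / eps)%:E * (0 * 0) + (16 / 9 * B)%:E * mu E)%E).
  apply: cvgeD.
  - by rewrite mul0e mule0 fin_num_adde_defr.
  - by apply: cvgeZl => //; apply: cvgeM.
  - exact: cvg_cst.
have := cvge_to_ge cvg_bound.
rewrite mul0e mule0 add0e; apply.
exact: nearW.
Qed.

End Bessel.

(** * From the measure estimate to the bound on the density *)

Lemma ac_density_lower_bound (R : realType)
    (mu : {measure set (measurableTypeR R) -> \bar R}) (g : R -> R) (eps : R)
    (A : set (measurableTypeR R)) : is_ac_density mu g -> measurable A ->
  0 <= eps -> (forall x, A x -> eps <= g x) ->
  (eps%:E * @lebesgue_measure R A <= mu A)%E.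
Proof.
move=> [mg g0 [nu _ mu_split]] mA eps0 eps_g; rewrite mu_split//.
(* Discarding the nonnegative singular part only lowers the value. *)
apply: (@le_trans _ _ (\int[@lebesgue_measure R]_(x in A) (g x)%:E)%E); last first.
  exact: leeDl.
rewrite -integral_cst//; apply: ge0_le_integral => //.
by apply/measurable_EFinP; exact: measurable_funTS.
Qed.

Theorem theorem3p5 (R : realType)
    (mu : {finite_measure set (measurableTypeR R) -> \bar R})
    (mu_concentrated : mu (~` `[0, 1[) = 0%E)
    (g : R -> R) (g_density : is_ac_density mu g)
    (B : R) (h : int -> measurableTypeR R -> R[i]%C)
    (h_bessel : bessel_sequence mu h B)
    (h_dextrodual : dextrodual mu h (@exponential R)) :
  {ae @lebesgue_measure R, forall x, 0 < g x -> (3 * B)^-1 < g x}.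
Proof.
have B0 : 0 < B by case: h_bessel.
have [mg g0 [nu [N [mN nuN lebN]] mu_split]] := g_density.
have mI : measurable (`[0, 1[%classic : set (measurableTypeR R)) by [].
(* The sets [L k] exhaust the support of [g], and each gives a uniform lower bound on the
   density. *)
pose L k := [set x : measurableTypeR R | k.+1%:R^-1 <= g x].
pose U := [set x : measurableTypeR R | g x <= (3 * B)^-1].
have mL k : measurable (L k).
  by rewrite -[L k]setTI; apply: measurable_fun_le.
have mU : measurable U by rewrite -[U]setTI; apply: measurable_fun_le.
(* Apart from the Lebesgue-null carrier [N] of the singular part, a bad point lies either outside
   [0, 1), in some [F k], or inside it, in some [E k]. *)
pose F k : set (measurableTypeR R) := ~` `[0, 1[ `&` L k.
pose E k : set (measurableTypeR R) := `[0, 1[ `&` ~` N `&` (L k `&` U).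
have mF k : measurable (F k) by apply: measurableI => //; exact: measurableC.
have mE k : measurable (E k).
  apply: measurableI; last exact: measurableI.
  by apply: measurableI => //; exact: measurableC.
have low k A : measurable A -> A `<=` L k ->
    (k.+1%:R^-1%:E * @lebesgue_measure R A <= mu A)%E.
  by move=> mA AL; apply: (ac_density_lower_bound g_density) => //.
(* Outside [0, 1) [mu] vanishes, yet on [L k] it dominates a positive multiple of Lebesgue
   measure. *)
have F0 k : @lebesgue_measure R (F k) = 0%E.
  have muF : mu (F k) = 0%E.
    apply/eqP; rewrite -measure_le0 -mu_concentrated.
    apply: le_measure; rewrite ?inE//; first exact: measurableC.
    exact: subIsetl.
  have := low k _ (mF k) (@subIsetr _ _ _).
  rewrite muF => le0; apply/eqP; rewrite -measure_le0.
  by move: le0; rewrite -lee_pdivlMl ?invr_gt0// mule0.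
have E0 k : @lebesgue_measure R (E k) = 0%E.
  have sub01 : E k `<=` `[0, 1].
    by move=> x [[]]; rewrite /= !in_itv/= => /andP[-> /ltW ->].
  (* Finiteness matters: t <= (16/27) t with t >= 0 forces t = 0 only when t is not [+oo]. *)
  have leE1 : (@lebesgue_measure R (E k) <= 1)%E.
    by rewrite -(lebesgue_measure01 R); apply: le_measure; rewrite ?inE.
  have nuE : nu (E k) = 0%E.
    apply/eqP; rewrite -measure_le0 -nuN.
    apply: le_measure; rewrite ?inE//; first exact: measurableC.
    by move=> x [[]].
  (* [E k] avoids [N], so only the density contributes, and it is at most 1/(3B) on [U]. *)
  have muE : (mu (E k) <= (3 * B)^-1%:E * @lebesgue_measure R (E k))%E.
    rewrite mu_split// nuE adde0 -integral_cst//; apply: ge0_le_integral => //.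
    - by move=> x _; rewrite lee_fin.
    - by apply/measurable_EFinP; exact: measurable_funTS.
    - by move=> x [_ []].
  have := lebesgue_le_bessel h_bessel h_dextrodual (mE k) sub01
    (eps := k.+1%:R^-1).
  rewrite invr_gt0 ltr0n => /(_ isT) /(_ _)/wrap[|leE].
    by move=> A mA AE; apply: low => // x /AE[_ []].
  have : (@lebesgue_measure R (E k) <= (16 / 27)%:E * @lebesgue_measure R (E k))%E.
    apply: (le_trans leE).
    (* The factor 16/9 from the approximation and 1/3 from the assumed upper bound on [g] combine to
       a ratio below 1. *)
    rewrite (_ : (16 / 27 : R) = 16 / 9 * B * (3 * B)^-1); last first.
      by field; rewrite gt_eqF.
    rewrite [in leRHS]EFinM -[leRHS]muleA; apply: lee_wpmul2l => //.
    by rewrite lee_fin mulr_ge0// ltW.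
  have : (0 <= @lebesgue_measure R (E k))%E by [].
  case: (@lebesgue_measure R (E k)) leE1 => [r| |]//.
  by rewrite -EFinM !lee_fin => _ r0 r1; congr EFin; lra.
have neg : (@lebesgue_measure R).-negligible (N `|` \bigcup_k (F k `|` E k)).
  apply: negligibleU; first exact/negligibleP.
  apply: negligible_bigcup => k.
  by apply: negligibleU; apply/negligibleP; [|exact: F0| |exact: E0].
apply: negligibleS neg => x /= /not_implyP[gx /negP]; rewrite -leNgt => gB.
have [Nx|nNx] := pselect (N x); [by left|right].
have [k gk] : exists k, L k x.
  have [k] := ltr_add_invr gx; rewrite add0r => kg.
  by exists k; exact: ltW.
exists k => //; have [Ix|nIx] := pselect (`[0, 1[%classic x); last by left.
by right.
Qed.
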